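(* (1) For every $\delta>0$ there are constants $k\in\mathbb N$ and $\eta>0$, depending only on $\delta$, such that for every $A\subseteq\mathbb Z$ with $d^{*}(A)=\delta$ there is some $a\in A$ such that $A+A-A-a$ contains a Bohr-$(k,\eta)$ set. (2) For every $\delta>0$ and every $\varepsilon>0$ there are constants $k\in\mathbb N$ and $\eta>0$, depending only on $\delta$ and $\varepsilon$, such that for every $A\subseteq\mathbb Z$ with $d^{*}(A)=\delta$ there is a set $A'\subseteq A$ satisfying $d^{*}(A\setminus A')<\varepsilon$ and such that $A+A-A-a'$ contains a Bohr-$(k,\eta)$ set for all $a'\in A'$.
   Context: For $t\in\mathbb R$, $\|t\|$ denotes the distance from $t$ to the nearest integer. For $k\in\mathbb N$ and $\eta>0$, a Bohr-$(k,\eta)$ set (in $\mathbb Z$) is a set of the form $\{n\in\mathbb Z:\max_{1\le i\le k}\|s_i n\|<\eta\}$, where $s_1,\dots,s_k$ are real numbers. For $A\subseteq\mathbb Z$, $A+A-A=\{a+b-c: a,b,c\in A\}$, and $A+A-A-a$ is its translate by $-a$. A Følner sequence for $\mathbb Z$ is a sequence $\mathbf\Phi=(\Phi_n)_{n\in\mathbb N}$ of finite (nonempty) subsets of $\mathbb Z$ such that $\lim_{n\to\infty}|\Phi_n\triangle(\Phi_n+\gamma)|/|\Phi_n|=0$ for every $\gamma\in\mathbb Z$. Write $d_{\mathbf\Phi}(A)=\lim_{n\to\infty}|A\cap\Phi_n|/|\Phi_n|$ when the limit exists. The upper Banach density of $A$ is $d^{*}(A)=\sup\{d_{\mathbf\Phi}(A)\}$,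 the supremum being over Følner sequences $\mathbf\Phi$ for which the limit exists. *)

(* Defs.v *)
From HB Require Import structures.
From mathcomp Require Import all_boot all_order all_algebra finmap.
From mathcomp Require Import all_classical all_reals all_analysis.

Set Implicit Arguments.
Unset Strict Implicit.
Unset Printing Implicit Defensive.

Import Order.TTheory GRing.Theory Num.Theory.
Import numFieldNormedType.Exports.

Local Open Scope classical_set_scope.
Local Open Scope ring_scope.

Definition dist_int (R : realType) (t : R) : R :=
  inf [set `|t - m%:~R| | m in [set: int]].

(* The neutral element 0 of the max is harmless, [dist_int] being nonnegative;
   it only matters for the empty family [k = 0]. *)
Definition bohr_set (R : realType) (k : nat) (s : 'I_k -> R) (eta : R) :
    set int :=
  [set n : int | \big[Num.max/0]_(i < k) dist_int (s i * n%:~R) < eta].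

Definition contains_bohr (R : realType) (k : nat) (eta : R) (S : set int) :
    Prop :=
  exists s : 'I_k -> R, bohr_set s eta `<=` S.

Definition translate (S : set int) (g : int) : set int := [set x + g | x in S].

Definition sumdiff (A : set int) : set int :=
  [set n : int | exists a b c : int, [/\ A a, A b, A c & n = a + b - c]].

Definition fsymdiff (E F : {fset int}) : {fset int} :=
  ((E `\` F) `|` (F `\` E))%fset.

Definition ftranslate (E : {fset int}) (g : int) : {fset int} :=
  [fset (x + g)%R | x in E]%fset.

Definition folner (R : realType) (Phi : nat -> {fset int}) : Prop :=
  (forall n, Phi n != fset0%fset) /\
  (forall g : int,
     (#|` fsymdiff (Phi n) (ftranslate (Phi n) g)|%:R / #|` Phi n|%:R : R)
       @[n --> \oo] --> (0 : R)).

Definition has_density (R : realType) (Phi : nat -> {fset int}) (A : set int)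
    (d : R) : Prop :=
  (#|` [fset x in Phi n | x \in A]%fset|%:R / #|` Phi n|%:R : R)
    @[n --> \oo] --> d.

(* A real supremum: the set below is nonempty (by compactness of [0, 1]) and
   contained in [0, 1]. *)
Definition upper_banach_density (R : realType) (A : set int) : R :=
  sup [set d : R | exists2 Phi, folner R Phi & has_density Phi A d].

(* Main.v *)
Require Import Defs.
From HB Require Import structures.
From mathcomp Require Import all_boot all_order all_algebra finmap.
From mathcomp Require Import all_classical all_reals all_analysis.
From mathcomp Require Import zify ring lra.

Set Implicit Arguments.
Unset Strict Implicit.
Unset Printing Implicit Defensive.

Import Order.TTheory GRing.Theory Num.Theory.
Import numFieldNormedType.Exports.
Local Open Scope classical_set_scope.
Local Open Scope ring_scope.

(** Fix [A] of upper Banach density at least [delta] and an invariant mean [m]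
    on the bounded functions on the integers for which [f], the indicator of
    [A], has mean [d > delta / 2] ([exists_density_mean]). The correlation [phi
    n = m (f c * f (c + n))] is positive only if [n] lies in [A - A], so a
    positive value at [y] of the triple convolution [F y = m (f b * phi (y -
    b))] puts [y] in [A + A - A]. The aim is a point [a] of [A] and a Bohr set
    of shifts [x] with [F (a + x) > 0].

    The function [phi - d ^+ 2] is positive definite ([posdef_correlation]).
    Its spectral measure has only boundedly many large atoms, and a positive
    definite function without large atoms is small in quadratic mean, by
    Wiener's lemma. In terms of quadratic forms alone:
    [exists_frequency] finds a cosine correlating with a positive definite
    function that is large in quadratic mean, [posdef_sub_cos] subtracts it
    preserving positive definiteness, and the iteration [posdef_decomposition]
    stops after boundedly many steps, at [phi - d ^+ 2 = g + kap * (sum of at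
    most n cosines)] with [g] small.

    Accordingly [F = d ^+ 3 + P + E]. The error [E] is uniformly small
    ([mean_conv_small]). The term [P] is a trigonometric polynomial with few
    frequencies, hence moves little under the shifts of a Bohr set defined by
    these frequencies, and its mean against [f] is a sum of squares
    ([mean_conv_cos_ge0]), so it is almost nonnegative at some [a] in [A]. Thus
    [F (a + x)] is at least [d ^+ 3] minus small errors for all [x] in the Bohr
    set, whose rank and radius depend on [delta] only
    ([exists_bohr_in_sumdiff]).

    The second assertion follows from the first, applied with density [eps] to
    the set of points of [A] at which it fails with the constants for [eps]. *)

(** * Invariant means on the integers *)

Definition is_bounded (R : realType) (T : Type) (g : T -> R) : Prop :=
  exists C : R, forall x, `|g x| <= C.

Lemma is_bounded_cst (R : realType) (T : Type) (c : R) : is_bounded (fun _ : T => c).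
Proof. by exists `|c|. Qed.

Lemma is_boundedD (R : realType) (T : Type) (g h : T -> R) :
  is_bounded g -> is_bounded h -> is_bounded (fun x => g x + h x).
Proof.
move=> [C gC] [D hD]; exists (C + D) => x.
by rewrite (le_trans (ler_normD _ _))// lerD.
Qed.

Lemma is_boundedN (R : realType) (T : Type) (g : T -> R) :
  is_bounded g -> is_bounded (fun x => - g x).
Proof. by move=> [C gC]; exists C => x; rewrite normrN. Qed.

Lemma is_boundedM (R : realType) (T : Type) (g h : T -> R) :
  is_bounded g -> is_bounded h -> is_bounded (fun x => g x * h x).
Proof.
by move=> [C gC] [D hD]; exists (C * D) => x; rewrite normrM ler_pM.
Qed.

Lemma is_boundedX (R : realType) (T : Type) (g : T -> R) n :
  is_bounded g -> is_bounded (fun x => g x ^+ n).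
Proof.
by move=> [C gC]; exists (C ^+ n) => x; rewrite normrX lerXn2r ?nnegrE// (le_trans _ (gC x)).
Qed.

Lemma is_bounded_comp (R : realType) (T U : Type) (u : T -> U) (g : U -> R) :
  is_bounded g -> is_bounded (fun x => g (u x)).
Proof. by move=> [C gC]; exists C. Qed.

Lemma is_bounded_sum (R : realType) (T I : Type) (r : seq I) (g : I -> T -> R) :
  (forall i, is_bounded (g i)) -> is_bounded (fun x => \sum_(i <- r) g i x).
Proof.
move=> bg; elim: r => [|i r IH].
  by exists 0 => x; rewrite big_nil normr0.
under eq_fun do rewrite big_cons.
exact: is_boundedD.
Qed.

Lemma is_bounded_cos (R : realType) (T : Type) (g : T -> R) : is_bounded (fun x => cos (g x)).
Proof. by exists 1 => x; rewrite cos_max. Qed.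

Lemma is_bounded_sin (R : realType) (T : Type) (g : T -> R) : is_bounded (fun x => sin (g x)).
Proof. by exists 1 => x; rewrite sin_max. Qed.

(** The means below are linear only on bounded functions, so each use of
    linearity leaves boundedness goals that follow the shape of the term. *)
Ltac bounded := repeat match goal with
  | H : is_bounded ?g |- is_bounded ?g => exact: H
  | H : is_bounded ?g |- is_bounded (fun x => ?g _) => exact: (is_bounded_comp _ H)
  | |- is_bounded (fun x => _ ^+ _) => apply: is_boundedX
  | |- is_bounded (fun x => _ * _) => apply: is_boundedM
  | |- is_bounded (fun x => _ + _) => apply: is_boundedD
  | |- is_bounded (fun x => - _) => apply: is_boundedN
  | |- is_bounded (fun x => cos _) => exact: is_bounded_cos
  | |- is_bounded (fun x => sin _) => exact: is_bounded_sin
  | |- is_bounded (fun x => \sum_(i <- _) _) => apply: is_bounded_sum => ?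
  | |- is_bounded (fun x => _) => exact: is_bounded_cst
  end.

(** The laws are required of bounded functions only; the value of a mean at an
    unbounded function is junk. *)
Record invariant_mean (R : realType) := InvariantMean {
  mean :> (int -> R) -> R;
  meanD : forall g h, is_bounded g -> is_bounded h ->
    mean (fun x => g x + h x) = mean g + mean h;
  meanZ : forall c g, is_bounded g -> mean (fun x => c * g x) = c * mean g;
  mean_ge0 : forall g, is_bounded g -> (forall x, 0 <= g x) -> 0 <= mean g;
  mean1 : mean (fun=> 1) = 1;
  meanS : forall g, is_bounded g -> mean (fun x => g (x + 1)) = mean g }.

Section means.
Context (R : realType) (m : invariant_mean R).
Implicit Types g h : int -> R.

Lemma mean_cst (c : R) : m (fun=> c) = c.
Proof.
have -> : (fun _ : int => c) = (fun x => c * (fun=> 1) x).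
  by apply/funext => x; rewrite mulr1.
by rewrite meanZ ?mean1 ?mulr1//; exact: is_bounded_cst.
Qed.

Lemma meanN g : is_bounded g -> m (fun x => - g x) = - m g.
Proof.
move=> bg; have -> : (fun x => - g x) = (fun x => -1 * g x).
  by apply/funext => x; rewrite mulN1r.
by rewrite meanZ// mulN1r.
Qed.

Lemma meanB g h : is_bounded g -> is_bounded h -> m (fun x => g x - h x) = m g - m h.
Proof. by move=> bg bh; rewrite meanD ?meanN//; bounded. Qed.

Lemma le_mean g h : is_bounded g -> is_bounded h -> (forall x, g x <= h x) -> m g <= m h.
Proof.
move=> bg bh gh; rewrite -subr_ge0 -meanB//; apply: mean_ge0; first by bounded.
by move=> x; rewrite subr_ge0.
Qed.

Lemma mean_norm_le g (c : R) : (forall x, `|g x| <= c) -> `|m g| <= c.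
Proof.
move=> gc; have bg : is_bounded g by exists c.
rewrite ler_norml -{1}(mean_cst (- c)) -{2}(mean_cst c).
by apply/andP; split; apply: le_mean => // [|x]; try exact: is_bounded_cst;
  have := gc x; rewrite ler_norml => /andP[].
Qed.

Lemma mean_sum (I : Type) (r : seq I) (g : I -> int -> R) :
  (forall i, is_bounded (g i)) ->
  m (fun x => \sum_(i <- r) g i x) = \sum_(i <- r) m (g i).
Proof.
move=> bg; elim: r => [|i r IH].
  by under eq_fun do rewrite big_nil; rewrite mean_cst big_nil.
under eq_fun do rewrite big_cons.
by rewrite meanD// ?IH ?big_cons//; exact: is_bounded_sum.
Qed.

Lemma mean_shift g (p : int) : is_bounded g -> m (fun x => g (x + p)) = m g.
Proof.
move=> bg.
have nat_shift h (n : nat) : is_bounded h -> m (fun x => h (x + n%:Z)) = m h.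
  move=> bh; elim: n => [|n IH].
    by congr (m _); apply/funext => x; rewrite addr0.
  rewrite -[RHS]IH -[RHS]meanS; last by bounded.
  by congr (m _); apply/funext => x; congr h; lia.
case: p => n; first exact: nat_shift.
rewrite -(nat_shift _ n.+1); last by bounded.
by congr (m _); apply/funext => x; congr g; lia.
Qed.

Lemma mean_gt0_exists g : is_bounded g -> 0 < m g -> exists x, 0 < g x.
Proof.
move=> bg; apply: contraPP => /forallNP g0.
apply/negP; rewrite -leNgt -(mean_cst 0); apply: le_mean => //.
  exact: is_bounded_cst.
by move=> x; rewrite leNgt; apply/negP.
Qed.

End means.

Definition avg (R : realType) (s : seq int) (g : int -> R) : R :=
  (size s)%:R^-1 * \sum_(x <- s) g x.

Lemma avgD (R : realType) (s : seq int) (g h : int -> R) :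
  avg s (fun x => g x + h x) = avg s g + avg s h.
Proof. by rewrite /avg big_split mulrDr. Qed.

Lemma avgZ (R : realType) (s : seq int) (c : R) (g : int -> R) :
  avg s (fun x => c * g x) = c * avg s g.
Proof. by rewrite /avg -mulr_sumr mulrCA. Qed.

Lemma avg_ge0 (R : realType) (s : seq int) (g : int -> R) :
  (forall x, 0 <= g x) -> 0 <= avg s g.
Proof. by move=> g0; rewrite mulr_ge0// sumr_ge0. Qed.

Lemma avg_norm_le (R : realType) (s : seq int) (g : int -> R) C :
  s != [::] -> (forall x, `|g x| <= C) -> `|avg s g| <= C.
Proof.
move=> s0 gC; rewrite normrM normfV normr_nat.
have sz : 0 < (size s)%:R :> R by rewrite ltr0n lt0n size_eq0.
rewrite ler_pdivrMl//; apply: (le_trans (ler_norm_sum _ _ _)).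
apply: (le_trans (ler_sum _ (fun x _ => gC x))).
by rewrite big_const_seq count_predT iter_addr_0 mulr_natl.
Qed.

(** Averages of a bounded function stay in a segment, which is compact, so they
    converge along any ultrafilter; an ultrafilter finer than the filter of
    cofinite sets makes all of them converge simultaneously, and the limits
    inherit linearity and, by the second hypothesis, invariance. *)
Lemma mean_of_averages (R : realType) (P : nat -> seq int) :
  (forall i, P i != [::]) ->
  (forall g : int -> R, is_bounded g ->
     avg (P i) (fun x => g (x + 1)) - avg (P i) g @[i --> \oo] --> 0) ->
  exists (m : invariant_mean R) (G : set_system nat),
    [/\ ProperFilter G, \oo `<=` G &
      forall g : int -> R, is_bounded g -> avg (P i) g @[i --> G] --> m g].
Proof.
move=> P0 Pinv.
have [G [GU ooG]] := @ultraFilterLemma nat \oo _.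
have GP : ProperFilter G by exact: ultra_proper.
have cvgG (g : int -> R) : is_bounded g -> cvg (avg (P i) g @[i --> G]).
  move=> [C gC].
  (* The image of an ultrafilter is an ultrafilter. *)
  have FU : UltraFilter (avg (P i) g @[i --> G]).
    split; first exact: fmap_proper_filter.
    move=> H HF sH; apply/seteqP; split => // B HB.
    have [//|GnB] := @in_ultra_setVsetC _ _ ((fun i => avg (P i) g) @^-1` B) GU.
    have HnB : H (~` B) by exact: sH.
    have : H (B `&` ~` B) by exact: filterI.
    by rewrite setICr => /filter_not_empty.
  have := @segment_compact R (- C) C; rewrite compact_ultra => /(_ _ FU).
  case.
    suff: \forall i \near G, `[(- C), C]%classic (avg (P i) g) by [].
    apply: nearW => i /=; rewrite in_itv/= -ler_norml.
    exact: avg_norm_le.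
  by move=> l [_ /= Fl]; apply/cvg_ex; exists l.
pose m (g : int -> R) : R := lim (avg (P i) g @[i --> G]).
have mE (g : int -> R) : is_bounded g -> avg (P i) g @[i --> G] --> m g.
  exact: cvgG.
have mu (g : int -> R) l : avg (P i) g @[i --> G] --> l -> m g = l.
  by move=> gl; apply/cvg_lim.
unshelve eexists; first unshelve eapply (@InvariantMean R m).
- move=> g h bg bh; apply: mu; under eq_fun do rewrite avgD.
  by apply: cvgD; exact: mE.
- move=> c g bg; apply: mu; under eq_fun do rewrite avgZ.
  by apply: cvgMr; exact: mE.
- move=> g bg g0; apply: limr_ge; first exact: cvgG.
  by apply: nearW => i; exact: avg_ge0.
- apply: mu; under eq_fun.
    move=> i; rewrite /avg big_const_seq count_predT iter_addr_0 mulVf.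
      over.
    by rewrite pnatr_eq0 size_eq0.
  exact: cvg_cst.
- move=> g bg; apply: mu.
  have -> : (fun i => avg (P i) (fun x => g (x + 1))) =
     (fun i => (avg (P i) (fun x => g (x + 1)) - avg (P i) g) + avg (P i) g).
    by apply/funext => i; rewrite subrK.
  rewrite -[m g]add0r; apply: cvgD; last exact: mE.
  by apply: cvg_trans (Pinv g bg) => B /ooG.
by exists G; split.
Qed.

(** * Positive definite functions on the integers *)

(** Real-valued positive definiteness: testing real coefficients suffices
    because the function is required to be even. Lists may repeat points, so
    that two families of test vectors are added by concatenation. *)
Definition posdef (R : realType) (f : int -> R) : Prop :=
  (forall n, f (- n) = f n) /\
  (forall s : seq (R * int),
     0 <= \sum_(p <- s) \sum_(q <- s) p.1 * q.1 * f (p.2 - q.2)).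

Section posdef.
Context (R : realType).
Implicit Types f : int -> R.

Lemma posdef_family_ge0 f (I : Type) (r : seq I) (c : I -> R) (x : I -> int) :
  posdef f ->
  0 <= \sum_(i <- r) \sum_(j <- r) c i * c j * f (x i - x j).
Proof.
move=> [_ /(_ [seq (c i, x i) | i <- r])]; rewrite big_map /=.
by under eq_bigr do rewrite big_map /=.
Qed.

Lemma posdef0_ge0 f : posdef f -> 0 <= f 0.
Proof. by move=> [_ /(_ [:: (1, 0)])]; rewrite !big_seq1 /= subr0 !mul1r. Qed.

Lemma posdef_norm_le f n : posdef f -> `|f n| <= f 0.
Proof.
move=> [fN fs]; have := fs [:: (1, 0); (1, n)]; have := fs [:: (1, 0); (-1, n)].
rewrite !big_cons !big_nil /= !subr0 !subrr sub0r fN ler_norml => h1 h2.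
by apply/andP; split; lra.
Qed.

Lemma posdef_is_bounded f : posdef f -> is_bounded f.
Proof. by move=> fp; exists (f 0) => n; exact: posdef_norm_le. Qed.

(** The form measures a squared norm, and translating one of two equal vectors
    can only decrease the modulus of their inner product. The proof tests
    positivity at the sum and the difference of the vector and its translate.
    *)
Lemma posdef_translates_le f (s : seq (R * int)) (d : int) : posdef f ->
  `|\sum_(p <- s) \sum_(q <- s) p.1 * q.1 * f (p.2 - q.2 + d)| <=
  \sum_(p <- s) \sum_(q <- s) p.1 * q.1 * f (p.2 - q.2).
Proof.
move=> [fN fs].
set b0 := leRHS; set b := \sum_(p <- s) _.
have bE : b = \sum_(p <- s) \sum_(q <- s) p.1 * q.1 * f (p.2 - q.2 - d).
  rewrite /b exchange_big; apply: eq_bigr => p _; apply: eq_bigr => q _ /=.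
  rewrite [q.1 * _]mulrC -[in LHS]fN.
  by congr (_ * f _); lia.
have sgn (e : R) : e ^+ 2 = 1 -> 0 <= b0 + (e * b) *+ 2 + b0.
  move=> e2.
  have := fs (s ++ [seq (e * p.1, p.2 + d) | p <- s]).
  rewrite big_cat /= big_map /=.
  under eq_bigr do rewrite big_cat /= big_map /=.
  under [X in _ + X]eq_bigr do rewrite big_cat /= big_map /=.
  rewrite !big_split /= -/b0.
  have -> : \sum_(p <- s) \sum_(q <- s) p.1 * (e * q.1) * f (p.2 - (q.2 + d)) = e * b.
    rewrite bE mulr_sumr; apply: eq_bigr => p _; rewrite mulr_sumr.
    apply: eq_bigr => q _.
    have -> : p.2 - (q.2 + d) = p.2 - q.2 - d by lia.
    by ring.
  have -> : \sum_(p <- s) \sum_(q <- s) e * p.1 * q.1 * f (p.2 + d - q.2) = e * b.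
    rewrite mulr_sumr; apply: eq_bigr => p _; rewrite mulr_sumr.
    apply: eq_bigr => q _.
    have -> : p.2 + d - q.2 = p.2 - q.2 + d by lia.
    by ring.
  have -> : \sum_(p <- s) \sum_(q <- s) e * p.1 * (e * q.1) * f (p.2 + d - (q.2 + d)) = b0.
    apply: eq_bigr => p _; apply: eq_bigr => q _.
    have -> : p.2 + d - (q.2 + d) = p.2 - q.2 by lia.
    by rewrite mulrACA -expr2 e2 mul1r.
  lra.
rewrite ler_norml; apply/andP; split.
  by have := sgn 1 (expr1n _ _); lra.
by have := sgn (-1); rewrite sqrrN expr1n => /(_ erefl); lra.
Qed.

(** Cauchy-Schwarz between the unit mass at [y] and the vector with
    coefficients [c], in the arithmetic-geometric form obtained by testing
    positivity at [t] times the unit mass plus or minus that vector. *)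
Lemma posdef_cross_le f (I : Type) (r : seq I) (c : I -> R) (x : I -> int)
    (y : int) (t : R) :
  posdef f -> f 0 <= 1 -> 0 < t ->
  \sum_(i <- r) \sum_(j <- r) c i * c j * f (x i - x j) <= t ^+ 2 ->
  `|\sum_(i <- r) c i * f (y - x i)| <= t.
Proof.
move=> [fN fs] f1 t0 ut.
set b := \sum_(i <- r) _.
have sgn (e : R) : e ^+ 2 = 1 -> 0 <= t ^+ 2 + (e * t * b) *+ 2 + t ^+ 2.
  move=> e2.
  have := fs ((e * t, y) :: [seq (c i, x i) | i <- r]).
  rewrite !big_cons !big_map /= subrr.
  under [X in _ + X]eq_bigr do rewrite big_cons big_map /=.
  rewrite big_split /=.
  have -> : \sum_(i <- r) e * t * c i * f (y - x i) = e * t * b.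
    by rewrite mulr_sumr; apply: eq_bigr => i _; rewrite mulrA.
  have -> : \sum_(i <- r) c i * (e * t) * f (x i - y) = e * t * b.
    rewrite mulr_sumr; apply: eq_bigr => i _.
    have -> : x i - y = - (y - x i) by lia.
    by rewrite fN; ring.
  have -> : e * t * (e * t) * f 0 = t ^+ 2 * f 0 by rewrite -mulrACA -!expr2 e2 mul1r.
  have : t ^+ 2 * f 0 <= t ^+ 2 by rewrite ler_piMr// sqr_ge0.
  set B := \sum_(i <- r) \sum_(j <- r) _ in ut *.
  lra.
rewrite ler_norml; apply/andP; split.
  have := sgn 1 (expr1n _ _); rewrite mul1r.
  by move=> h; rewrite -(ler_pM2l t0) mulrN -expr2; lra.
have := sgn (-1); rewrite sqrrN expr1n => /(_ erefl) h.
by rewrite -(ler_pM2l t0) -expr2; move: h; rewrite mulN1r mulNr; lra.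
Qed.

Lemma posdef_cos (theta : R) : posdef (fun n : int => cos (theta * n%:~R)).
Proof.
split=> [n|s]; first by rewrite mulrNz mulrN cosN.
under eq_bigr => p _. under eq_bigr => q _.
  rewrite intrB mulrBr cosB.
  have -> : p.1 * q.1 * (cos (theta * p.2%:~R) * cos (theta * q.2%:~R) +
    sin (theta * p.2%:~R) * sin (theta * q.2%:~R)) =
    (p.1 * cos (theta * p.2%:~R)) * (q.1 * cos (theta * q.2%:~R)) +
    (p.1 * sin (theta * p.2%:~R)) * (q.1 * sin (theta * q.2%:~R)) by ring.
  over.
  rewrite big_split /= -!mulr_sumr. over.
by rewrite big_split /= -!mulr_suml addr_ge0// -expr2 sqr_ge0.
Qed.

Lemma posdefM_cos f (theta : R) : posdef f ->
  posdef (fun n => f n * cos (theta * n%:~R)).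
Proof.
move=> fp; split=> [n|s]; first by rewrite fp.1 mulrNz mulrN cosN.
under eq_bigr => p _. under eq_bigr => q _.
  rewrite intrB mulrBr cosB.
  have -> : p.1 * q.1 * (f (p.2 - q.2) * (cos (theta * p.2%:~R) * cos (theta * q.2%:~R) +
    sin (theta * p.2%:~R) * sin (theta * q.2%:~R))) =
    (p.1 * cos (theta * p.2%:~R)) * (q.1 * cos (theta * q.2%:~R)) * f (p.2 - q.2) +
    (p.1 * sin (theta * p.2%:~R)) * (q.1 * sin (theta * q.2%:~R)) * f (p.2 - q.2) by ring.
  over.
  rewrite big_split /=. over.
by rewrite big_split /= addr_ge0//; exact: (posdef_family_ge0 _ _ _ fp).
Qed.

Lemma posdefD f g : posdef f -> posdef g -> posdef (fun n => f n + g n).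
Proof.
move=> fp gp; split=> [n|s]; first by rewrite fp.1 gp.1.
under eq_bigr do (under eq_bigr do rewrite mulrDr; rewrite big_split).
by rewrite big_split addr_ge0//; [exact: fp.2|exact: gp.2].
Qed.

Lemma posdefZ f (k : R) : 0 <= k -> posdef f -> posdef (fun n => k * f n).
Proof.
move=> k0 fp; split=> [n|s]; first by rewrite fp.1.
under eq_bigr do (under eq_bigr do rewrite mulrCA; rewrite -mulr_sumr).
by rewrite -mulr_sumr mulr_ge0// fp.2.
Qed.

(** If the spectral measure of [f] has an atom of mass [v] at [theta], then [f]
    minus its contribution is still positive definite. Indeed, for a finitely
    supported vector [s], let [b d] be its inner product with its translate by
    [d]. The mean of [b d * cos (theta *
    d)] is at most [b 0], and by invariance it equals [v] times the value of
    the cosine form at [s]. The sine terms vanish because the mean kills odd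
    functions. *)
Lemma posdef_sub_cos (m : invariant_mean R) f (theta : R) :
  (forall g, is_bounded g -> (forall n, g (- n) = - g n) -> m g = 0) ->
  posdef f ->
  posdef (fun n => f n - m (fun d => f d * cos (theta * d%:~R)) * cos (theta * n%:~R)).
Proof.
move=> modd fp; have bf := posdef_is_bounded fp.
set v := m _.
split=> [n|s]; first by rewrite fp.1 mulrNz mulrN cosN.
have corr (p : int) : m (fun d => cos (theta * d%:~R) * f (p + d)) =
    v * cos (theta * p%:~R).
  have -> : m (fun d => cos (theta * d%:~R) * f (p + d)) =
      m (fun d => cos (theta * p%:~R) * (f d * cos (theta * d%:~R)) +
                  sin (theta * p%:~R) * (f d * sin (theta * d%:~R))).
    rewrite -[LHS](@mean_shift _ _ _ (- p)); last by bounded.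
    congr (m _); apply/funext => d; rewrite intrB mulrBr cosB.
    have -> : p + (d - p) = d by lia.
    by ring.
  rewrite meanD; [|by bounded..]; rewrite !meanZ; [|by bounded..].
  rewrite (modd (fun d => f d * sin (theta * d%:~R))); first by rewrite mulr0 addr0 mulrC.
    by bounded.
  by move=> n; rewrite fp.1 mulrNz mulrN sinN mulrN.
under eq_bigr do (under eq_bigr do rewrite mulrBr; rewrite sumrB).
rewrite sumrB subr_ge0.
set b0 := leRHS.
pose b d := \sum_(p <- s) \sum_(q <- s) p.1 * q.1 * f (p.2 - q.2 + d).
have bb : is_bounded b by rewrite /b; bounded.
have -> : \sum_(i <- s) \sum_(i0 <- s)
    i.1 * i0.1 * (v * cos (theta * (i.2 - i0.2)%:~R)) =
    m (fun d => cos (theta * d%:~R) * b d).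
  under [in RHS]eq_fun do rewrite /b mulr_sumr.
  rewrite mean_sum; last by move=> p; bounded.
  apply: eq_bigr => p _.
  under [in RHS]eq_fun do rewrite mulr_sumr.
  rewrite mean_sum; last by move=> q; bounded.
  apply: eq_bigr => q _.
  rewrite -corr -meanZ; last by bounded.
  by congr (m _); apply/funext => d; ring.
rewrite -[leRHS](mean_cst m); apply: le_mean; [by bounded|exact: is_bounded_cst|].
move=> d.
have bd := posdef_translates_le s d fp.
rewrite (le_trans (ler_norm _))// normrM.
by rewrite (le_trans _ bd)// ler_piMl// cos_max.
Qed.

End posdef.

(** * Fourier analysis on a finite grid of frequencies *)

Lemma cosD2pi_int (R : realType) (x : R) (n : int) :
  cos (x + pi *+ 2 * n%:~R) = cos x.
Proof.
case: n => n.
  rewrite -[n%:~R]/(n%:R : R) mulr_natr; exact: (periodicn (@cosD2pi R)).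
rewrite NegzE mulrNz mulrN -[LHS](periodicn (@cosD2pi R) n.+1).
by rewrite -[n.+1%:~R]/(n.+1%:R : R) mulr_natr subrK.
Qed.

Lemma sinD2pi_int (R : realType) (x : R) (n : int) :
  sin (x + pi *+ 2 * n%:~R) = sin x.
Proof. by rewrite -!cosBpihalf addrAC cosD2pi_int. Qed.

Definition grid_freq (R : realType) (M t : nat) : R := pi *+ 2 * t%:R / M%:R.

(** Multiplying by [sin y], with [y] half the step of the angle, turns the sum
    into a telescoping one. *)
Lemma sum_cos_grid (R : realType) (M : nat) (n : int) : (`|n| < M)%N ->
  \sum_(0 <= t < M) cos (grid_freq R M t * n%:~R) = (n == 0)%:R * M%:R.
Proof.
move=> nM; have [->|n0] := eqVneq n 0.
  under eq_bigr do rewrite mulr0 cos0.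
  by rewrite sumr_const_nat subn0 mul1r.
rewrite mul0r; set y : R := pi * n%:~R / M%:R.
have M0 : 0 < M%:R :> R by rewrite ltr0n; lia.
have siny : sin y != 0.
  have pos (z : R) : 0 < z -> z < M%:R -> 0 < sin (pi * z / M%:R).
    move=> z0 zM; apply: sin_gt0_pi.
    rewrite divr_gt0 ?mulr_gt0 ?pi_gt0//=.
    by rewrite ltr_pdivrMr// ltr_pM2l ?pi_gt0.
  have [np|nn|/eqP] := ltgtP n 0; last by rewrite (negbTE n0).
    rewrite -(opprK y) sinN oppr_eq0 gt_eqF// /y -mulNr -mulrN -mulrNz pos//.
      by rewrite ltr0z; lia.
    by rewrite -[M%:R]/(M%:Z%:~R) ltr_int; lia.
  rewrite gt_eqF// pos ?ltr0z//.
  by rewrite -[M%:R]/(M%:Z%:~R) ltr_int; lia.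
apply: (mulfI siny); apply: (@mulIf R 2); first by rewrite pnatr_eq0.
rewrite mulr0 mul0r mulr_sumr mulr_suml.
have tel t : sin y * cos (grid_freq R M t * n%:~R) * 2 =
    sin (y * (t.+1.*2%:R - 1)) - sin (y * (t.*2%:R - 1)).
  have -> : y * (t.+1.*2%:R - 1) = grid_freq R M t * n%:~R + y.
    rewrite /y /grid_freq -muln2 natrM -natr1; field.
    by rewrite gt_eqF.
  have -> : y * (t.*2%:R - 1) = grid_freq R M t * n%:~R - y.
    rewrite /y /grid_freq -muln2 natrM; field.
    by rewrite gt_eqF.
  by rewrite sinD sinB; ring.
under eq_bigr do rewrite tel.
rewrite telescope_sumr//= -muln2 natrM mulrBr.
have -> : y * (M%:R * 2) - y * 1 = - y + pi *+ 2 * n%:~R.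
  by rewrite /y; field; rewrite gt_eqF.
by rewrite sinD2pi_int sub0r mulrN1 subrr.
Qed.

Lemma sum_cos_grid_mul (R : realType) (M : nat) (c d : int) :
  (`|c| + `|d| < M)%N ->
  \sum_(0 <= t < M) cos (grid_freq R M t * c%:~R) * cos (grid_freq R M t * d%:~R) =
  ((c == d)%:R + (c == - d)%:R) * (M%:R / 2).
Proof.
move=> cdM.
have prod t : cos (grid_freq R M t * c%:~R) * cos (grid_freq R M t * d%:~R) =
    (cos (grid_freq R M t * (c - d)%:~R) + cos (grid_freq R M t * (c + d)%:~R)) / 2.
  by rewrite intrB intrD mulrBr mulrDr cosB cosD; field.
under eq_bigr do rewrite prod.
rewrite -mulr_suml big_split /= !sum_cos_grid; [|lia..].
by rewrite subr_eq0 addr_eq0; field.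
Qed.

Definition diffsum (R : realType) (N : nat) (f : int -> R) : R :=
  \sum_(0 <= j < N) \sum_(0 <= k < N) f (j%:Z - k%:Z).

Section diffsum.
Context (R : realType).
Implicit Types f g : int -> R.

Lemma eq_diffsum N f g : f =1 g -> diffsum N f = diffsum N g.
Proof. by move=> fg; do 2 apply: eq_bigr => ? _; exact: fg. Qed.

Lemma diffsum_sum N (I : Type) (r : seq I) (f : I -> int -> R) :
  diffsum N (fun d => \sum_(i <- r) f i d) = \sum_(i <- r) diffsum N (f i).
Proof.
rewrite /diffsum; under eq_bigr do rewrite exchange_big.
by rewrite exchange_big.
Qed.

Lemma diffsumZ N (c : R) f : diffsum N (fun d => c * f d) = c * diffsum N f.
Proof.
rewrite /diffsum mulr_sumr; apply: eq_bigr => j _ /=.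
by rewrite mulr_sumr.
Qed.

Lemma le_diffsum N f g :
  (forall j k, (j < N)%N -> (k < N)%N -> f (j%:Z - k%:Z) <= g (j%:Z - k%:Z)) ->
  diffsum N f <= diffsum N g.
Proof.
move=> fg; rewrite /diffsum !big_nat; apply: ler_sum => j jN.
by rewrite !big_nat; apply: ler_sum => k kN; exact: fg.
Qed.

Lemma diffsum_cst N (c : R) : diffsum N (fun=> c) = N%:R ^+ 2 * c.
Proof.
by rewrite /diffsum !sumr_const_nat subn0 expr2 -mulrA !mulr_natl.
Qed.

Lemma diffsum_reflect N f : diffsum N (fun d => f (- d)) = diffsum N f.
Proof.
rewrite {1}/diffsum exchange_big; do 2 apply: eq_bigr => ? _.
by rewrite opprB.
Qed.

Lemma posdef_diffsum_ge0 N f : posdef f -> 0 <= diffsum N f.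
Proof.
move=> fp; have := posdef_family_ge0 (index_iota 0 N) (fun=> 1) (fun j : nat => j%:Z) fp.
by under eq_bigr do under eq_bigr do rewrite !mul1r.
Qed.

(** Up to normalisation, [diffsum N f] is the squared norm of the average of
    the first [N] translates of a vector. The first [2 N] translates average to
    the midpoint of two vectors of the same norm, whence the bound; it is
    positivity at the difference of these two vectors. *)
Lemma posdef_diffsum_double N f : posdef f ->
  diffsum (2 * N) f <= 4 * diffsum N f.
Proof.
move=> fp.
pose c (i : nat) : R := if (i < N)%N then 1 else -1.
have := posdef_family_ge0 (index_iota 0 (2 * N)) c (fun j : nat => j%:Z) fp.
have split2 (F : nat -> R) : \sum_(0 <= i < 2 * N) F i =
    \sum_(0 <= i < N) F i + \sum_(0 <= i < N) F (i + N)%N.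
  rewrite (@big_cat_nat _ _ _ N)//=; last by lia.
  by congr (_ + _); rewrite -{1}[N]add0n big_addn mul2n -addnn addnK.
pose S a b : R :=
  \sum_(0 <= j < N) \sum_(0 <= k < N) f ((j + a)%N%:Z - (k + b)%N%:Z).
have SE a : S a a = diffsum N f.
  by do 2 apply: eq_bigr => ? _; congr f; lia.
have -> : diffsum (2 * N) f = (S 0 0 + S 0 N) + (S N 0 + S N N).
  rewrite /diffsum split2; congr (_ + _); rewrite -big_split; apply: eq_bigr => j _;
  rewrite split2 /=; congr (_ + _); apply: eq_bigr => k _; congr f; lia.
have cl j : (j < N)%N -> c j = 1 by rewrite /c => ->.
have cr j : c (j + N)%N = -1 by rewrite /c ltnNge leq_addl.
set T := (X in 0 <= X -> _).
have -> : T = (S 0 0 - S 0 N) + (- S N 0 + S N N).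
  rewrite /T split2; congr (_ + _).
    rewrite -sumrB !big_nat; apply: eq_bigr => j /andP[_ jN].
    rewrite split2 (cl j)// -sumrN; congr (_ + _); last first.
      by apply: eq_bigr => k _; rewrite cr mul1r mulN1r addn0.
    rewrite !big_nat; apply: eq_bigr => k /andP[_ kN].
    by rewrite cl// !mul1r !addn0.
  rewrite -sumrN -big_split; apply: eq_bigr => j _.
  rewrite split2 cr -sumrN; congr (_ + _); last first.
    by apply: eq_bigr => k _; rewrite cr mulrNN !mul1r.
  rewrite !big_nat; apply: eq_bigr => k /andP[_ kN].
  by rewrite cl// mulr1 mulN1r addn0.
by rewrite !SE; lra.
Qed.

End diffsum.

(** * A frequency correlating with a positive definite function *)

Lemma sum_nat_delta (R : realType) (N j : nat) : (j < N)%N ->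
  \sum_(0 <= k < N) (k == j)%:R = 1 :> R.
Proof.
move=> jN; have -> : \sum_(0 <= k < N) (k == j)%:R =
    \sum_(0 <= k < N | k == j) 1 :> R.
  by rewrite [RHS]big_mkcond; apply: eq_bigr => k _; case: eqP.
by rewrite big_nat1_eq jN.
Qed.

Lemma diffsum_delta0 (R : realType) (N : nat) :
  diffsum N (fun d => (d == 0)%:R) = N%:R :> R.
Proof.
rewrite /diffsum big_nat; under eq_bigr => j /andP[_ jN].
  under eq_bigr do rewrite subr_eq0 eq_sym.
  rewrite (_ : \sum_(0 <= k < N) _ = 1); last exact: sum_nat_delta.
  over.
by rewrite -big_nat sumr_const_nat subn0.
Qed.

Lemma diffsum_delta_ge (R : realType) (N j k : nat) : (j < N)%N -> (k < N)%N ->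
  N%:R <= diffsum (2 * N) (fun d => (d == j%:Z - k%:Z)%:R) :> R.
Proof.
move=> jN kN.
pose G (i : nat) : R := \sum_(0 <= l < 2 * N) (i%:Z - l%:Z == j%:Z - k%:Z)%:R.
have G0 i : 0 <= G i by rewrite sumr_ge0.
rewrite -[leRHS]/(\sum_(0 <= i < 2 * N) G i).
rewrite (@big_cat_nat _ _ _ j)//=; last by lia.
rewrite (@big_cat_nat _ _ _ (j + N) j)//=; [|by lia..].
rewrite [leRHS]addrCA ler_wpDr ?addr_ge0 ?sumr_ge0//.
have -> : N%:R = \sum_(j <= i < j + N) 1 :> R by rewrite sumr_const_nat addKn.
rewrite !big_nat; apply: ler_sum => i /andP[ji iN].
rewrite /G -[leLHS](@sum_nat_delta R (2 * N) (i - j + k)); last by lia.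
apply: ler_sum => l _; case: (l =P (i - j + k)%N) => [->|_]; last by rewrite ler_nat.
by have -> : i%:Z - (i - j + k)%N%:Z == j%:Z - k%:Z by apply/eqP; lia.
Qed.

(** Parseval on the grid of [4 N] frequencies. With [V t] and [W t] the
    correlations of [f] with the [t]-th cosine at scales [N] and [2 N],
    orthogonality bounds the sum of the [W t * V t] from below by a multiple of
    the square sum of [f], while the sum of the [W t] is a multiple of [f 0].
    All these numbers are nonnegative, so the largest [V t] is at least their
    ratio. The scale [2 N] guarantees that each difference occurring at scale
    [N] is represented at least [N] times. *)
Lemma exists_frequency_at_scale (R : realType) (f : int -> R) (N : nat) :
  posdef f -> f 0 <= 1 -> (0 < N)%N ->
  exists2 t, (t < 4 * N)%N &
    diffsum N (fun d => f d ^+ 2) <=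
    2 * diffsum N (fun d => f d * cos (grid_freq R (4 * N) t * d%:~R)).
Proof.
move=> fp f1 N0; set M := (4 * N)%N; set Q := diffsum N _.
pose g t d : R := f d * cos (grid_freq R M t * d%:~R).
pose V t := diffsum N (g t); pose W t := diffsum (2 * N) (g t).
have V0 t : 0 <= V t by apply/posdef_diffsum_ge0/posdefM_cos.
have W0 t : 0 <= W t by apply/posdef_diffsum_ge0/posdefM_cos.
have M0 : (0 < M)%N by lia.
have sumW : \sum_(0 <= t < M) W t <= M%:R * (2 * N%:R).
  rewrite -diffsum_sum.
  have -> : M%:R * (2 * N%:R) = diffsum (2 * N) (fun d => M%:R * (d == 0)%:R) :> R.
    by rewrite diffsumZ diffsum_delta0 natrM.
  apply: le_diffsum => j k jN kN.
  rewrite -mulr_sumr sum_cos_grid; last by lia.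
  case: eqP => [->|_]; last by rewrite mul0r !mulr0.
  by rewrite mul1r mulr1 ler_piMl.
have sumVW : M%:R * N%:R * Q <= \sum_(0 <= t < M) W t * V t.
  under eq_bigr do rewrite /V -diffsumZ.
  rewrite -diffsum_sum -diffsumZ; apply: le_diffsum => j k jN kN.
  set d := j%:Z - k%:Z.
  have dN : (`|d| < N)%N by lia.
  have -> : \sum_(0 <= t < M) W t * g t d =
      diffsum (2 * N) (fun e => f d * f e *
        \sum_(0 <= t < M) cos (grid_freq R M t * e%:~R) * cos (grid_freq R M t * d%:~R)).
    under eq_bigr do rewrite mulrC -diffsumZ.
    rewrite -diffsum_sum; apply: eq_diffsum => e.
    by rewrite mulr_sumr; apply: eq_bigr => t _; rewrite /g; ring.
  pose h e : R := f d ^+ 2 * (M%:R / 2) * ((e == d)%:R + (- e == d)%:R).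
  have -> : diffsum (2 * N) (fun e => f d * f e *
        \sum_(0 <= t < M) cos (grid_freq R M t * e%:~R) * cos (grid_freq R M t * d%:~R)) =
      diffsum (2 * N) h.
    rewrite /diffsum !big_nat; apply: eq_bigr => a aN.
    rewrite !big_nat; apply: eq_bigr => b bN.
    rewrite sum_cos_grid_mul /h; last by lia.
    rewrite -eqr_oppLR; set e := a%:Z - b%:Z.
    case: (e =P d) => [->|_]; case: eqP => [ed|_] /=; try by ring.
    by rewrite -[f e]fp.1 ed; ring.
  rewrite /h diffsumZ.
  have -> : diffsum (2 * N) (fun e => (e == d)%:R + (- e == d)%:R) =
      2 * diffsum (2 * N) (fun e => (e == d)%:R) :> R.
    rewrite mulr_natl mulr2n -[X in _ = _ + X]diffsum_reflect /diffsum -big_split.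
    by apply: eq_bigr => a _; rewrite -big_split.
  have := @diffsum_delta_ge R N j k jN kN; rewrite -/d.
  set D := diffsum _ _ => ND.
  have := ler_wpM2l (mulr_ge0 (sqr_ge0 (f d)) (ler0n R M)) ND.
  have -> : f d ^+ 2 * (M%:R / 2) * (2 * D) = f d ^+ 2 * M%:R * D by field.
  by have -> : M%:R * N%:R * f d ^+ 2 = f d ^+ 2 * M%:R * N%:R by ring.
have [t _ tmax] := @arg_maxP _ _ _ (Ordinal M0) xpredT (fun t : 'I_M => V t) erefl.
exists t => //; rewrite -/(g t) -/(V t).
have MN0 : 0 < M%:R * N%:R :> R by rewrite mulr_gt0 ?ltr0n.
rewrite -(ler_pM2l MN0) (le_trans sumVW)//.
have -> : M%:R * N%:R * (2 * V t) = M%:R * (2 * N%:R) * V t by ring.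
rewrite (le_trans _ (ler_wpM2r (V0 t) sumW))// mulr_suml !big_mkord.
by apply: ler_sum => i _; apply: ler_wpM2l => //; exact: tmax.
Qed.

(** Wiener's lemma: a positive definite function that is not small in quadratic
    mean has a spectral atom. Along the scales [2 ^ i] the normalised
    correlation with a fixed cosine is nonincreasing, so a frequency that works
    at one scale works at all smaller ones, and a cluster point of the
    frequencies found at each scale works at all scales. *)
Lemma exists_frequency (R : realType) (f : int -> R) (eps : R) :
  posdef f -> f 0 <= 1 ->
  (forall N, (0 < N)%N -> eps * N%:R ^+ 2 <= diffsum N (fun d => f d ^+ 2)) ->
  exists theta : R, forall i,
    eps / 2 * (2 ^ i)%:R ^+ 2 <=
    diffsum (2 ^ i) (fun d => f d * cos (theta * d%:~R)).
Proof.
move=> fp f1 fQ.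
pose V i theta := diffsum (2 ^ i) (fun d => f d * cos (theta * d%:~R)).
(* Monotonicity in the scale, for normalised correlations. *)
have dbl i theta : V i.+1 theta <= 4 * V i theta.
  by rewrite /V expnS; apply/posdef_diffsum_double/posdefM_cos.
have Vdec i k theta : eps / 2 * (2 ^ (k + i))%:R ^+ 2 <= V (k + i)%N theta ->
    eps / 2 * (2 ^ i)%:R ^+ 2 <= V i theta.
  elim: k => [//|k IH] H; apply: IH; move: (le_trans H (dbl _ _)).
  by rewrite addSn expnS natrM exprMn; lra.
have /choice[th thP] : forall i, exists theta : R, `[0, pi *+ 2]%classic theta /\
    eps / 2 * (2 ^ i)%:R ^+ 2 <= V i theta.
  move=> i; have N0 : (0 < 2 ^ i)%N by rewrite expn_gt0.
  have [t tM tQ] := exists_frequency_at_scale fp f1 N0.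
  exists (grid_freq R (4 * 2 ^ i) t); split.
    have M0 : 0 < (4 * 2 ^ i)%:R :> R by rewrite ltr0n muln_gt0.
    have p0 : 0 < pi *+ 2 :> R by rewrite mulrn_wgt0// pi_gt0.
    rewrite /= in_itv/= /grid_freq divr_ge0 ?mulr_ge0 ?(ltW p0)//=.
    by rewrite ler_pdivrMr// ler_pM2l// ler_nat ltnW.
  by have := le_trans (fQ _ N0) tQ; rewrite -/(V i _); lra.
have [theta [_ thcl]] : `[0, pi *+ 2]%classic `&` cluster (th @ \oo) !=set0.
  apply: segment_compact.
  by exists 0%N => // i _; exact: (thP i).1.
exists theta => i; rewrite -/(V i theta) leNgt; apply/negP => Vlt.
have Vc : {for theta, continuous (V i)}.
  rewrite /V /diffsum.
  apply: cvg_big => [|j _]; first by move=> x; exact: add_continuous.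
  apply: cvg_big => [|k _]; first by move=> x; exact: add_continuous.
  apply: cvgMr; apply: continuous_comp; last exact: continuous_cos.
  by apply: cvgMl; exact: cvg_id.
have nb : nbhs theta [set x | V i x < eps / 2 * (2 ^ i)%:R ^+ 2].
  exact: (cvgr_lt _ Vc _ Vlt).
have tl : (th @ \oo) [set x | eps / 2 * (2 ^ i)%:R ^+ 2 <= V i x].
  exists i => // k /= ik; apply: (@Vdec i (k - i)%N); rewrite subnK//.
  exact: (thP k).2.
have [x [/= x1 x2]] := thcl _ _ tl nb.
by move: (le_lt_trans x1 x2); rewrite ltxx.
Qed.

(** * Splitting off finitely many cosines *)

Lemma diffsum_shift_le (R : realType) (N : nat) (g : int -> R) (C : R) :
  (forall x, `|g x| <= C) ->
  `|diffsum N (fun d => g (d + 1)) - diffsum N g| <= N%:R * (2 * C).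
Proof.
move=> gC; rewrite /diffsum -sumrB /=; under eq_bigr do rewrite -sumrB.
rewrite exchange_big /=.
under eq_bigr => k _.
  under eq_bigr => j _.
    have -> : j%:Z - k%:Z + 1 = j.+1%:Z - k%:Z by lia.
    over.
  rewrite (telescope_sumr (fun j : nat => g (j%:Z - k%:Z)))//.
  over.
rewrite (le_trans (ler_norm_sum _ _ _))//.
have -> : N%:R * (2 * C) = \sum_(0 <= k < N) 2 * C.
  by rewrite sumr_const_nat subn0 mulr_natl.
apply: ler_sum => k _; rewrite (le_trans (ler_normB _ _))//.
by rewrite mulr_natl mulr2n lerD.
Qed.

(** The limit, along the scales [2 ^ i], of the averages of [g (j - k)] over
    the squares [0 <= j, k < 2 ^ i]. Unlike averages over intervals, these are
    the averages in which positive definiteness controls correlations with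
    cosines, and they are symmetric. *)
Lemma exists_box_mean (R : realType) : exists m : invariant_mean R,
  (forall g, is_bounded g -> (forall n, g (- n) = - g n) -> m g = 0) /\
  (forall g (c : R), is_bounded g ->
    (forall i, c * (2 ^ i)%:R ^+ 2 <= diffsum (2 ^ i) g) -> c <= m g).
Proof.
pose r i := index_iota 0 (2 ^ i).
pose P i := [seq j%:Z - k%:Z | j <- r i, k <- r i].
have N0 i : 0 < (2 ^ i)%:R :> R by rewrite ltr0n expn_gt0.
have szP i : size (P i) = (2 ^ i * 2 ^ i)%N.
  by rewrite size_allpairs /r size_iota subn0.
have avgP i g : avg (P i) g = (2 ^ i)%:R ^- 2 * diffsum (2 ^ i) g :> R.
  by rewrite /avg szP natrM -expr2 big_allpairs_dep.
have [||m [G [GP ooG mP]]] := @mean_of_averages R P.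
- by move=> i; rewrite -size_eq0 szP -lt0n muln_gt0 expn_gt0.
- move=> g [C gC]; apply/norm_cvg0P.
  have : 2 * C * (2^-1) ^+ i @[i --> \oo] --> (2 * C * 0 : R).
    apply: cvgMr; apply: cvg_expr; rewrite gtr0_norm ?invr_gt0//.
    by rewrite invf_lt1// ltr1n.
  rewrite mulr0 => cv; apply: (squeeze_cvgr _ (cvg_cst 0) cv).
  apply: nearW => i; rewrite normr_ge0 !avgP -mulrBr normrM.
  rewrite gtr0_norm ?invr_gt0 ?exprn_gt0// ler_pdivrMl ?exprn_gt0//.
  rewrite (le_trans (diffsum_shift_le (2 ^ i) gC))// exprVn natrX.
  rewrite le_eqVlt; apply/orP; left; apply/eqP; field.
  by rewrite expf_neq0.
exists m; split=> [g bg godd|g c bg gc].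
  have cvgm := mP _ bg.
  apply/esym/(cvg_unique _ _ cvgm); first exact: norm_hausdorff.
  have -> : (fun i => avg (P i) g) = (fun=> 0).
    apply/funext => i; rewrite avgP; suff -> : diffsum (2 ^ i) g = 0 by rewrite mulr0.
    have := diffsum_reflect (2 ^ i) g.
    have -> : diffsum (2 ^ i) (fun d => g (- d)) = - diffsum (2 ^ i) g.
      by rewrite -mulN1r -diffsumZ; apply: eq_diffsum => d; rewrite mulN1r.
    by move=> h; lra.
  exact: cvg_cst.
apply: (cvgr_to_ge (mP _ bg)); apply: nearW => i.
by rewrite avgP ler_pdivlMl ?exprn_gt0// mulrC.
Qed.

(** As long as the remainder is not small in quadratic mean at any scale, a
    cosine of weight [eps / 2] can be subtracted from it. Each step lowers the
    value at [0], which stays nonnegative, by [eps / 2], so that the number of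
    steps is bounded in terms of [eps] alone. *)
Lemma posdef_decomposition (R : realType) (eps : R) (n : nat) (f : int -> R) :
  0 < eps -> posdef f -> f 0 <= 1 -> f 0 <= n%:R * (eps / 2) ->
  exists (ths : seq R) (g : int -> R),
    [/\ (size ths <= n)%N, posdef g, g 0 <= 1,
        forall d, f d = g d + eps / 2 * \sum_(th <- ths) cos (th * d%:~R) &
        exists2 N, (0 < N)%N &
          diffsum N (fun d => g d ^+ 2) < eps * N%:R ^+ 2].
Proof.
move=> eps0; have [m [modd mge]] := exists_box_mean R.
elim: n f => [|n IH] f fp f1 fn.
  exists [::], f; split=> // [d|]; first by rewrite big_nil mulr0 addr0.
  exists 1%N => //; rewrite /diffsum !big_nat1 subrr expr1n mulr1.
  have -> : f 0 = 0 by apply/eqP; rewrite eq_le posdef0_ge0// andbT; move: fn; rewrite mul0r.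
  by rewrite expr0n.
have [[N N0 fN]|noN] := pselect (exists2 N, (0 < N)%N &
    diffsum N (fun d => f d ^+ 2) < eps * N%:R ^+ 2).
  exists [::], f; split=> // [d|]; first by rewrite big_nil mulr0 addr0.
  by exists N.
have [|theta thP] := @exists_frequency _ f eps fp f1.
  by move=> N N0; rewrite leNgt; apply/negP => fN; apply: noN; exists N.
set v := m (fun d => f d * cos (theta * d%:~R)).
have ev : eps / 2 <= v.
  by apply: mge => //; have bf := posdef_is_bounded fp; bounded.
pose f' d := f d - eps / 2 * cos (theta * d%:~R).
have fp' : posdef f'.
  have -> : f' = (fun d => (f d - v * cos (theta * d%:~R)) +
      (v - eps / 2) * cos (theta * d%:~R)).
    by apply/funext => d; rewrite /f'; ring.
  apply: posdefD; first exact: posdef_sub_cos.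
  by apply: posdefZ; [rewrite subr_ge0|exact: posdef_cos].
have f'0 : f' 0 = f 0 - eps / 2 by rewrite /f' mulr0 cos0 mulr1.
have [||ths [g [sz gp g1 f'E gN]]] := IH f' fp'.
- by rewrite f'0; lra.
- by rewrite f'0; move: fn; rewrite -natr1; lra.
exists (theta :: ths), g; split=> // d.
have := f'E d; rewrite /f' big_cons; lra.
Qed.

(** * Density, means and Lipschitz bounds *)

Lemma sum_fset_sub (R : realType) (E U : {fset int}) (g : int -> R) :
  (E `<=` U)%fset -> \sum_(x <- E) g x = \sum_(x <- U) (x \in E)%:R * g x.
Proof.
move=> EU; rewrite -(big_fset_incl _ EU); last first.
  by move=> x _ /negbTE ->; rewrite mul0r.
by apply: eq_big_seq => x ->; rewrite mul1r.
Qed.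

Lemma card_fset_sub (R : realType) (E U : {fset int}) :
  (E `<=` U)%fset -> #|` E|%:R = \sum_(x <- U) (x \in E)%:R :> R.
Proof.
move=> EU; rewrite card_fset_sum1 natr_sum (sum_fset_sub _ EU).
by apply: eq_bigr => x _; rewrite mulr1.
Qed.

Lemma sum_fset_dist_le (R : realType) (E F : {fset int}) (g : int -> R) (C : R) :
  (forall x, `|g x| <= C) ->
  `|\sum_(x <- F) g x - \sum_(x <- E) g x| <= C * #|` fsymdiff E F|%:R.
Proof.
move=> gC; have EU : (E `<=` E `|` F)%fset by exact: fsubsetUl.
have FU : (F `<=` E `|` F)%fset by exact: fsubsetUr.
have SU : (fsymdiff E F `<=` E `|` F)%fset.
  by apply/fsubsetP => x; rewrite !inE => /orP[/andP[_ ->]|/andP[_ ->]]; rewrite ?orbT.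
rewrite (sum_fset_sub _ EU) (sum_fset_sub _ FU) (card_fset_sub _ SU) -sumrB mulr_sumr.
rewrite (le_trans (ler_norm_sum _ _ _))//; apply: ler_sum => x _.
rewrite -mulrBl normrM mulrC /fsymdiff !inE.
have C0 : 0 <= C by rewrite (le_trans _ (gC x)).
case: (x \in E); case: (x \in F);
  by rewrite /= ?subrr ?subr0 ?sub0r ?normrN ?normr0 ?normr1 ?mulr0 ?mulr1.
Qed.

(** The mean is a limit of averages over a Folner sequence along which [A] has
    a density greater than [d]. The hypothesis on the sign of [d] excludes the
    junk value of the supremum of an empty set. *)
Lemma exists_density_mean (R : realType) (A : set int) (d : R) :
  0 <= d -> d < upper_banach_density R A ->
  exists m : invariant_mean R, d < m (fun x => (x \in A)%:R).
Proof.
move=> d0; rewrite /upper_banach_density; set S := [set _ | _].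
have [->|/set0P S0] := eqVneq S set0.
  by rewrite sup0 => /(le_lt_trans d0); rewrite ltxx.
move=> /(sup_gt S0)[d' [Phi [Phi0 Phiinv] dens] dd'].
have c0 n : 0 < #|` Phi n|%:R :> R by rewrite ltr0n cardfs_gt0.
have [||m [G [GP ooG mP]]] := @mean_of_averages R (fun n => enum_fset (Phi n)).
- by move=> n; rewrite -size_eq0 -lt0n; have := c0 n; rewrite ltr0n.
- move=> g [C gC]; apply/norm_cvg0P.
  have : C * (#|` fsymdiff (Phi n) (ftranslate (Phi n) 1)|%:R / #|` Phi n|%:R : R)
      @[n --> \oo] --> (C * 0 : R).
    by apply: cvgMr; exact: Phiinv.
  rewrite mulr0 => cv; apply: (squeeze_cvgr _ (cvg_cst 0) cv).
  apply: nearW => n; rewrite normr_ge0 /avg -mulrBr normrM.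
  rewrite gtr0_norm ?invr_gt0// ler_pdivrMl//.
  rewrite [leRHS]mulrCA [X in C * X]mulrC divfK ?gt_eqF//.
  have -> : \sum_(x <- Phi n) g (x + 1) = \sum_(x <- ftranslate (Phi n) 1) g x.
    by rewrite big_imfset//= => x y _ _ /addIr.
  exact: sum_fset_dist_le.
exists m; rewrite (_ : m _ = d')//.
have bA : is_bounded (fun x => (x \in A)%:R : R).
  by exists 1 => x; case: (x \in A); rewrite ?normr1 ?normr0.
apply: (cvg_unique _ (mP _ bA)); first exact: norm_hausdorff.
have -> : (fun n => avg (Phi n) (fun x => (x \in A)%:R)) =
    (fun n => #|` [fset x in Phi n | x \in A]%fset|%:R / #|` Phi n|%:R : R).
  apply/funext => n; rewrite /avg mulrC; congr (_ / _).
  rewrite (@card_fset_sub _ _ (Phi n)); last first.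
    by apply/fsubsetP => x; rewrite !inE => /andP[].
  by apply: eq_big_seq => x xP; rewrite !inE xP.
by move=> B /dens /ooG.
Qed.

Lemma cos_lipschitz (R : realType) (x y : R) : `|cos x - cos y| <= `|x - y|.
Proof.
wlog xy : x y / x < y.
  move=> H; have [/H//|/H|->] := ltgtP x y; last by rewrite !subrr.
  by rewrite distrC (distrC x).
have [|c _ cE] := @MVT R cos (fun z => - sin z) x y xy.
  apply: continuous_subspaceT; exact: continuous_cos.
by rewrite distrC cE normrM normrN (distrC x) ler_piMl// sin_max.
Qed.

Lemma cos_dist_int (R : realType) (th x n eta : R) (k : int) :
  `|th / (pi *+ 2) * n - k%:~R| < eta ->
  `|cos (th * (x + n)) - cos (th * x)| <= pi *+ 2 * eta.
Proof.
move=> ke; have p0 : 0 < pi *+ 2 :> R by rewrite mulrn_wgt0// pi_gt0.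
rewrite -(cosD2pi_int (th * x) k) (le_trans (cos_lipschitz _ _))//.
have -> : th * (x + n) - (th * x + pi *+ 2 * k%:~R) =
    pi *+ 2 * (th / (pi *+ 2) * n - k%:~R).
  by move: (pi *+ 2) p0 => tau p0; field; rewrite gt_eqF.
by rewrite normrM gtr0_norm// ler_pM2l// ltW.
Qed.

(** * Correlations and convolutions along an invariant mean *)

Section convolution.
Context (R : realType) (m : invariant_mean R).
Implicit Types f g : int -> R.

(** The quadratic form at [s] is the mean of the square of a linear combination
    of translates of [f - m f]. *)
Lemma posdef_correlation f : is_bounded f ->
  posdef (fun n => m (fun c => f c * f (c + n)) - m f ^+ 2).
Proof.
move=> bf; have bft p : is_bounded (fun x => f (x + p)) by bounded.
split=> [n|s].
  congr (_ - _); rewrite -(@mean_shift _ m _ n); last by bounded.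
  by congr (m _); apply/funext => x; rewrite addrK mulrC.
set d := m f.
pose G p x := p.1 * (f (x + p.2) - d) : R.
have bG p : is_bounded (G p) by rewrite /G; bounded.
have -> : \sum_(p <- s) \sum_(q <- s) p.1 * q.1 *
    (m (fun c => f c * f (c + (p.2 - q.2))) - d ^+ 2) =
    m (fun x => (\sum_(p <- s) G p x) ^+ 2).
  under [in RHS]eq_fun do rewrite expr2 mulr_suml.
  rewrite mean_sum; last by move=> p; bounded.
  apply: eq_bigr => p _; under [in RHS]eq_fun do rewrite mulr_sumr.
  rewrite mean_sum; last by move=> q; bounded.
  apply: eq_bigr => q _.
  have -> : m (fun c => f c * f (c + (p.2 - q.2))) =
      m (fun x => f (x + p.2) * f (x + q.2)).
    rewrite -(@mean_shift _ m _ q.2); last by bounded.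
    congr (m _); apply/funext => x; rewrite mulrC.
    by have -> : x + q.2 + (p.2 - q.2) = x + p.2 by lia.
  have -> : (fun x => G p x * G q x) = (fun x => p.1 * q.1 *
      (f (x + p.2) * f (x + q.2) - d * f (x + p.2) - d * f (x + q.2) + d ^+ 2)).
    by apply/funext => x; rewrite /G; ring.
  rewrite meanZ; last by bounded.
  rewrite meanD; [|by bounded..]; rewrite !meanB; [|by bounded..].
  rewrite !meanZ; [|by bounded..]; rewrite mean_cst !mean_shift//.
  by rewrite -/d; ring.
by apply: mean_ge0 => [|x]; [bounded|exact: sqr_ge0].
Qed.

(** The iterated mean is the squared modulus of the Fourier coefficient of [f]
    at [th]. *)
Lemma mean_conv_cos_ge0 f (th : R) : is_bounded f ->
  0 <= m (fun y => f y * m (fun a => f a * cos (th * (y - a)%:~R))).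
Proof.
move=> bf.
set C := m (fun a => f a * cos (th * a%:~R)).
set S := m (fun a => f a * sin (th * a%:~R)).
have -> : (fun y => f y * m (fun a => f a * cos (th * (y - a)%:~R))) =
    (fun y => C * (f y * cos (th * y%:~R)) + S * (f y * sin (th * y%:~R))).
  apply/funext => y.
  have -> : (fun a => f a * cos (th * (y - a)%:~R)) =
      (fun a => cos (th * y%:~R) * (f a * cos (th * a%:~R)) +
                sin (th * y%:~R) * (f a * sin (th * a%:~R))).
    by apply/funext => a; rewrite intrB mulrBr cosB; ring.
  rewrite meanD; [|by bounded..]; rewrite !meanZ; [|by bounded..].
  by rewrite -/C -/S; ring.
rewrite meanD; [|by bounded..]; rewrite !meanZ; [|by bounded..].
by rewrite -/C -/S addr_ge0// -expr2 sqr_ge0.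
Qed.

(** By invariance [f a * g (x - a)] may first be averaged over the window of
    [a], [a + 1], ..., [a + N - 1]. The window average is an inner product of
    the unit mass at [x] with a vector whose squared norm is at most the
    average of [`|g|] over the differences of the window, hence is small when
    [g] is small in quadratic mean. *)
Lemma mean_conv_small f g (N : nat) (e : R) (x : int) :
  (forall a, 0 <= f a <= 1) -> posdef g -> g 0 <= 1 -> (0 < N)%N -> 0 < e ->
  diffsum N (fun d => g d ^+ 2) < e ^+ 4 * N%:R ^+ 2 ->
  `|m (fun a => f a * g (x - a))| <= e.
Proof.
move=> f01 gp g1 N0 e0 gN.
have bg := posdef_is_bounded gp.
have bf : is_bounded f by exists 1 => a; have /andP[? ?] := f01 a; rewrite ger0_norm.
have n0 : 0 < N%:R :> R by rewrite ltr0n.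
pose h a := f a * g (x - a); have bh : is_bounded h by rewrite /h; bounded.
have -> : m (fun a => f a * g (x - a)) =
    m (fun a => \sum_(0 <= j < N) N%:R^-1 * h (a + j%:Z)).
  rewrite mean_sum; last by move=> j; bounded.
  under eq_bigr => j _.
    rewrite meanZ; last by bounded.
    rewrite mean_shift//. over.
  by rewrite sumr_const_nat subn0 -mulrnAl -mulr_natl mulfV ?mul1r ?gt_eqF.
apply: mean_norm_le => a.
have -> : \sum_(0 <= j < N) N%:R^-1 * h (a + j%:Z) =
    \sum_(0 <= j < N) N%:R^-1 * f (a + j%:Z) * g (x - (a + j%:Z)).
  by apply: eq_bigr => j _; rewrite mulrA.
apply: posdef_cross_le => //.
pose u d : R := N%:R^-2 / 2 * (e ^- 2 * g d ^+ 2 + e ^+ 2).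
apply: (@le_trans _ _ (diffsum N u)).
  apply: ler_sum => j _; apply: ler_sum => k _; rewrite /u.
  have -> : a + j%:Z - (a + k%:Z) = j%:Z - k%:Z by lia.
  set gd := g _.
  have -> : N%:R^-1 * f (a + j%:Z) * (N%:R^-1 * f (a + k%:Z)) * gd =
      N%:R^-2 * (f (a + j%:Z) * f (a + k%:Z) * gd) by rewrite -exprVn; ring.
  rewrite -[leRHS]mulrA ler_pM2l ?invr_gt0 ?exprn_gt0//.
  have fgd : f (a + j%:Z) * f (a + k%:Z) * gd <= `|gd|.
    have /andP[fj0 fj1] := f01 (a + j%:Z); have /andP[fk0 fk1] := f01 (a + k%:Z).
    rewrite (le_trans (ler_norm _))// normrM ler_piMl// ger0_norm ?mulr_ge0//.
    by rewrite -[leRHS]mulr1 ler_pM.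
  apply: (le_trans fgd); rewrite -[gd ^+ 2]real_normK ?num_real//.
  have := sqr_ge0 (e^-1 * `|gd| - e).
  rewrite sqrrB exprMn exprVn mulrAC mulVf ?gt_eqF// mul1r.
  by set z := _ * `|gd| ^+ 2; lra.
have -> : diffsum N u = (e ^- 2 * (N%:R ^- 2 * diffsum N (fun d => g d ^+ 2)) + e ^+ 2) / 2.
  rewrite /u diffsumZ.
  have -> : diffsum N (fun d => e ^- 2 * g d ^+ 2 + e ^+ 2) =
      e ^- 2 * diffsum N (fun d => g d ^+ 2) + N%:R ^+ 2 * e ^+ 2.
    rewrite -diffsumZ -diffsum_cst /diffsum -big_split; apply: eq_bigr => j _.
    by rewrite -big_split.
  by field; rewrite !gt_eqF.
have : N%:R ^- 2 * diffsum N (fun d => g d ^+ 2) <= e ^+ 4.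
  by rewrite ler_pdivrMl ?exprn_gt0// mulrC ltW.
move/(ler_wpM2l (_ : 0 <= e ^- 2)) => /(_ (ltW _)).
have -> : e ^- 2 * e ^+ 4 = e ^+ 2 by field; rewrite gt_eqF.
rewrite invr_gt0 exprn_gt0// => /(_ erefl); lra.
Qed.

End convolution.

(** * Bohr sets in sums and differences *)

Lemma bohr_set_close (R : realType) (k : nat) (s : 'I_k -> R) (eta : R)
    (n : int) (i : 'I_k) :
  bohr_set s eta n -> exists z : int, `|s i * n%:~R - z%:~R| < eta.
Proof.
move=> /bigmax_ltP[_ /(_ i erefl)] /inf_lt[].
  by exists `|s i * n%:~R - 0%:~R|, 0.
by move=> _ [z _ <-] ?; exists z.
Qed.

(** The first assertion, with constants that work for all sets of density at
    least [delta]; this monotonicity is what makes the second assertion a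
    corollary. *)
Lemma exists_bohr_in_sumdiff (R : realType) (delta : R) : 0 < delta ->
  exists (k : nat) (eta : R), [/\ (0 < k)%N, 0 < eta &
    forall A : set int, delta <= upper_banach_density R A ->
      exists a : int,
        A a /\ contains_bohr k eta (translate (sumdiff A) (- a))].
Proof.
move=> delta0.
pose d0 := delta / 2; have d00 : 0 < d0 by rewrite divr_gt0.
(* At density [d], the main term is [d ^+ 3 > d0 ^+ 3 = 4 * e]; three errors,
   each at most [e], are subtracted from it below. *)
pose e := d0 ^+ 3 / 4; have e0 : 0 < e by rewrite divr_gt0// exprn_gt0.
pose kap := e ^+ 4 / 2; have kap0 : 0 < kap by rewrite divr_gt0// exprn_gt0.
(* Bounds the number of frequencies, each carrying mass [kap] out of [1]. *)
pose n := Num.bound kap^-1.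
have nkap : 1 <= n%:R * kap.
  have := @archi_boundP _ kap^-1; rewrite invr_ge0 ltW// => /(_ erefl) /ltW.
  by move/(ler_wpM2r (ltW kap0)); rewrite mulVf ?gt_eqF.
have tau0 : 0 < pi *+ 2 :> R by rewrite mulrn_wgt0// pi_gt0.
set tau : R := pi *+ 2 in tau0.
pose eta := e / (kap * n.+1%:R * tau).
have D0 : 0 < kap * n.+1%:R * tau by rewrite !mulr_gt0.
exists n.+1, eta; split=> //; first by rewrite divr_gt0.
move=> A Adelta.
have [|m md] := @exists_density_mean R A d0 (ltW d00).
  by rewrite (lt_le_trans _ Adelta)// /d0; lra.
set f : int -> R := fun x => (x \in A)%:R in md.
have f01 a : 0 <= f a <= 1 by rewrite /f; case: (a \in A); rewrite lexx ler01.
have bf : is_bounded f by exists 1 => a; have /andP[? ?] := f01 a; rewrite ger0_norm.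
set d := m f in md.
pose phi p := m (fun c => f c * f (c + p)).
have phi01 : phi 0 <= 1.
  rewrite -(mean_cst m 1); apply: le_mean; [by bounded|exact: is_bounded_cst|move=> c].
  by have /andP[c0 c1] := f01 c; rewrite addr0 -[leRHS]mulr1 ler_pM.
have psi1 : phi 0 - d ^+ 2 <= 1 by rewrite lerBlDr (le_trans phi01)// lerDl sqr_ge0.
have [|ths [g [sz gp g1 gE [N N0 gN]]]] :=
  posdef_decomposition (exprn_gt0 4 e0) (posdef_correlation m bf) psi1 (n := n).
  exact: le_trans psi1 nkap.
have bg := posdef_is_bounded gp.
have bphi : is_bounded phi.
  have [Cf fC] := bf; exists (Cf * Cf) => p; apply: mean_norm_le => c.
  by rewrite normrM ler_pM.
pose P y := kap * \sum_(th <- ths) m (fun a => f a * cos (th * (y - a)%:~R)).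
pose E y := m (fun a => f a * g (y - a)).
have Ee y : `|E y| <= e by exact: (mean_conv_small m y f01 gp g1 N0 e0 gN).
have convE y : m (fun a => f a * phi (y - a)) = d ^+ 3 + P y + E y.
  have -> : (fun a => f a * phi (y - a)) = (fun a => d ^+ 2 * f a +
      kap * (\sum_(th <- ths) f a * cos (th * (y - a)%:~R)) + f a * g (y - a)).
    apply/funext => a; have := gE (y - a); rewrite -/(phi _) -/d -mulr_sumr.
    by move/eqP; rewrite subr_eq => /eqP ->; rewrite /kap; ring.
  rewrite meanD; [|by bounded..]; rewrite meanD; [|by bounded..].
  rewrite !meanZ; [|by bounded..]; rewrite mean_sum; last by move=> th; bounded.
  by rewrite /P /E -/d; ring.
have bcos th : is_bounded (fun y => m (fun a => f a * cos (th * (y - a)%:~R))).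
  exists 1 => y; apply: mean_norm_le => a.
  have /andP[a0 a1] := f01 a.
  by rewrite normrM ger0_norm// -[leRHS]mulr1 ler_pM// cos_max.
have bP : is_bounded P by rewrite /P; bounded.
have fP0 : 0 <= m (fun y => f y * P y).
  have -> : (fun y => f y * P y) = (fun y => kap * \sum_(th <- ths)
      f y * m (fun a => f a * cos (th * (y - a)%:~R))).
    by apply/funext => y; rewrite /P mulrCA; congr (kap * _); rewrite mulr_sumr.
  rewrite meanZ; last by bounded.
  rewrite mean_sum; last by move=> th; bounded.
  by rewrite mulr_ge0 ?(ltW kap0)// sumr_ge0// => th _; exact: mean_conv_cos_ge0.
(* The almost periodic part cannot be very negative everywhere on [A], as its
   mean over [A] is nonnegative. *)
have [a [Aa Pa]] : exists a, A a /\ - e <= P a.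
  apply: contrapT => /forallNP nP; move: fP0; apply/negP; rewrite -ltNge.
  have : m (fun y => f y * P y) <= m (fun y => - e * f y).
    apply: le_mean; [by bounded..|move=> y; rewrite /f].
    case: (boolP (y \in A)) => [yA|_]; last by rewrite mul0r mulr0.
    rewrite mul1r mulr1 leNgt; apply/negP => Py; apply: (nP y).
    by split; [exact/set_mem|exact: ltW].
  rewrite meanZ// -/d => /le_lt_trans; apply.
  by rewrite mulNr oppr_lt0 mulr_gt0// (lt_trans d00).
exists a; split=> //.
exists (fun i => nth 0 ths i / tau) => x xB.
(* The Bohr set consists of almost periods of [P]. *)
have Pax : `|P (a + x) - P a| <= e.
  rewrite /P -mulrBr -sumrB normrM gtr0_norm//.
  have : `|\sum_(th <- ths) (m (fun b => f b * cos (th * (a + x - b)%:~R)) -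
      m (fun b => f b * cos (th * (a - b)%:~R)))| <= n%:R * (tau * eta).
    rewrite (le_trans (ler_norm_sum _ _ _))//.
    apply: (@le_trans _ _ (\sum_(th <- ths) tau * eta)); last first.
      rewrite big_const_seq count_predT iter_addr_0 -[leLHS]mulr_natl.
      by rewrite ler_pM2r ?ler_nat// mulr_gt0// divr_gt0.
    rewrite !big_seq; apply: ler_sum => th thP.
    rewrite -meanB; [|by bounded..]; apply: mean_norm_le => b.
    have ith : (index th ths < n.+1)%N.
      by rewrite ltnS (leq_trans _ sz)// ltnW// index_mem.
    have [z] := bohr_set_close (Ordinal ith) xB.
    rewrite /= nth_index// => /(cos_dist_int (a - b)%:~R) thz.
    rewrite -mulrBr normrM -[leRHS]mul1r ler_pM//.
      by have /andP[? ?] := f01 b; rewrite ger0_norm.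
    by rewrite addrAC (intrD _ (a - b)).
  move=> /(ler_wpM2l (ltW kap0)) /le_trans; apply.
  have -> : kap * (n%:R * (tau * eta)) = e * (n%:R / n.+1%:R).
    rewrite /eta; move: (tau) tau0 => t t0; field.
    by rewrite !gt_eqF// ltr0n.
  by rewrite ler_piMr ?(ltW e0)// ler_pdivrMr ?ltr0n// mul1r ler_nat.
have conv0 : 0 < m (fun b => f b * phi (a + x - b)).
  rewrite convE; have := Ee (a + x); rewrite ler_norml => /andP[Elo _].
  move: Pax; rewrite ler_norml => /andP[Plo _].
  have : d0 ^+ 3 < d ^+ 3 by rewrite ltrXn2r// ltW.
  have : d0 ^+ 3 = 4 * e by rewrite /e; field.
  lra.
(* Positivity of the triple convolution at [a + x] gives a representation. *)
have [|b fphi] := mean_gt0_exists _ conv0; first by bounded.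
have [bA phi0] : A b /\ 0 < phi (a + x - b).
  move: fphi; rewrite /f; case: (boolP (b \in A)) => [/set_mem bA|_].
    by rewrite mul1r.
  by rewrite mul0r ltxx.
have [|c] := mean_gt0_exists _ phi0; first by bounded.
rewrite /f; case: (boolP (c \in A)) => [/set_mem cA|_]; last by rewrite mul0r ltxx.
case: (boolP (c + (a + x - b) \in A)) => [/set_mem cA'|_ /=]; last by rewrite mulr0 ltxx.
move=> _; exists (a + x); last by ring.
by exists b, (c + (a + x - b)), c; split=> //; ring.
Qed.

Theorem theorem1p1 (R : realType) :
  (forall delta : R, 0 < delta ->
     exists (k : nat) (eta : R), [/\ (0 < k)%N, 0 < eta &
       forall A : set int, upper_banach_density R A = delta ->
         exists a : int,
           A a /\ contains_bohr k eta (translate (sumdiff A) (- a))])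
  /\
  (forall delta eps : R, 0 < delta -> 0 < eps ->
     exists (k : nat) (eta : R), [/\ (0 < k)%N, 0 < eta &
       forall A : set int, upper_banach_density R A = delta ->
         exists A' : set int,
           [/\ A' `<=` A,
               upper_banach_density R (A `\` A') < eps &
               forall a' : int, A' a' ->
                 contains_bohr k eta (translate (sumdiff A) (- a'))]]).
Proof.
split=> [delta delta0|delta eps _ eps0].
  have [k [eta [k0 eta0 H]]] := exists_bohr_in_sumdiff delta0.
  by exists k, eta; split=> // A Ad; apply: H; rewrite Ad.
have [k [eta [k0 eta0 H]]] := exists_bohr_in_sumdiff eps0.
exists k, eta; split=> // A _.
(* The set [B] of bad points of [A] has density below [eps]: otherwise some
   [b] in [B] would have a Bohr set in [B + B - B - b], hence in
   [A + A - A - b], and would be good. *)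
pose good a := contains_bohr k eta (translate (sumdiff A) (- a)).
exists [set a | A a /\ good a]; split=> [a []//||a []//].
rewrite ltNge; apply/negP => /H[b [[Ab bad] [s sB]]]; apply: bad; split=> //.
exists s => x /sB[y [c1 [c2 [c3 [[? _] [? _] [? _] ->]]]] <-].
by exists (c1 + c2 - c3) => //; exists c1, c2, c3.
Qed.
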